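(* Let $G$ be a graph which is not a star. Then $$\gamma_s(G^{\frac{1}{2}})\leq \min\{|E(G)|,\,|V(G)|\}.$$
   Context: All graphs are finite and simple. For a graph $G=(V,E)$, a set $D\subseteq V$ is a dominating set if every vertex of $V\setminus D$ is adjacent to at least one vertex of $D$. A dominating set $D$ is a secure dominating set if for every $u\in V\setminus D$ there exists $v\in D$ with $uv\in E$ such that $(D\setminus\{v\})\cup\{u\}$ is a dominating set of $G$. The secure domination number $\gamma_s(G)$ is the minimum cardinality of a secure dominating set of $G$. For $k\in\mathbb{N}$, the $k$-subdivision $G^{\frac{1}{k}}$ is the graph obtained from $G$ by replacing each edge $v_iv_j$ of $G$ by a path of length $k$ (with $k-1$ new internal vertices) joining $v_i$ and $v_j$. A star is a graph $K_{1,m}$.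
   Formalization: ''Not a star'' is read as ''no connected component of G is a star'' (the same for connected G); as literally stated the bound fails for disconnected graphs, e.g. G = 2K_2 has secure domination number 4 for its 2-subdivision but only 2 edges. *)

(* Defs.v *)
From HB Require Import structures.
From mathcomp Require Import all_boot.

Set Implicit Arguments.
Unset Strict Implicit.
Unset Printing Implicit Defensive.

Record sgraph := SGraph {
  vertex :> finType;
  adj : rel vertex;
  adj_sym : symmetric adj;
  adj_irr : irreflexive adj }.

Section Domination.
Variable G : sgraph.
Implicit Types D : {set G}.

Definition dominating D : bool :=
  [forall u, (u \notin D) ==> [exists v in D, adj u v]].

Definition secure_dominating D : bool :=
  dominating D &&
  [forall u, (u \notin D) ==>
     [exists v in D, adj u v && dominating (u |: (D :\ v))]].

Lemma secure_dominating_setT : secure_dominating [set: G].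
Proof. by apply/andP; split; apply/forallP => u; rewrite inE. Qed.

(* The default [set: G] of the arg min is a secure dominating set by
   secure_dominating_setT, so the minimum is attained. *)
Definition gamma_s : nat :=
  #|[arg min_(D < [set: G] | secure_dominating D) #|D|]|.

End Domination.

Section Subdivision.
Variables (k : nat) (G : sgraph).

(* An edge {u, v} is represented once, by the ordered pair of its ends that is
   increasing for the enumeration of the vertices; this also fixes the
   direction in which the path replacing the edge is parametrized. *)
Definition edges : {set G * G} :=
  [set p | adj p.1 p.2 && (enum_rank p.1 < enum_rank p.2)].

Definition edge : finType := {p : G * G | p \in edges}.

Definition subdiv_vertex : finType := (G + edge * 'I_k.-1)%type.

(* For 0 < k, the successive vertices, for j = 0, ..., k, of the path of length
   k replacing p; the j-th one is internal exactly when 0 < j < k. *)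
Definition subdiv_path (p : edge) (j : nat) : subdiv_vertex :=
  if j is i.+1 then
    if insub i is Some i' then inr (p, i') else inl (val p).2
  else inl (val p).1.

Definition subdiv_adj : rel subdiv_vertex := fun x y =>
  [exists p : edge, exists j : 'I_k,
     ((x == subdiv_path p j) && (y == subdiv_path p j.+1)) ||
     ((y == subdiv_path p j) && (x == subdiv_path p j.+1))].

Lemma subdiv_adj_sym : symmetric subdiv_adj.
Proof.
by move=> x y; apply: eq_existsb => p; apply: eq_existsb => j; rewrite orbC.
Qed.

Lemma subdiv_path_neq (p : edge) (j : 'I_k) :
  subdiv_path p j != subdiv_path p j.+1.
Proof.
case: j => [[|j] ltjk] /=.
- case: insubP => [//|_]; apply/eqP => -[p12].
  by have := valP p; rewrite inE p12 ltnn andbF.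
- have ltj : j < k.-1 by rewrite -ltnS (ltn_predK ltjk).
  rewrite (insubT (fun i => i < k.-1) ltj) /=.
  case: insubP => [i _ /= vi|_ //]; apply/eqP => -[] eji.
  by move: vi; rewrite -eji /= => /eqP; rewrite ltn_eqF.
Qed.

Lemma subdiv_adj_irr : irreflexive subdiv_adj.
Proof.
move=> x; apply/existsP => -[p /existsP[j]]; rewrite orbb => /andP[/eqP-> /eqP].
by move/eqP; rewrite (negPf (subdiv_path_neq p j)).
Qed.

Definition subdivision : sgraph := SGraph subdiv_adj_sym subdiv_adj_irr.

End Subdivision.

(* K_{1,m} with m >= 0: complete bipartite with parts {c} and everything else.
   In particular the one-vertex graph K_{1,0} is a star. *)
Definition is_star (G : sgraph) : bool :=
  [exists c : G, forall x : G, forall y : G,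
     adj x y == ((x == c) != (y == c))].

Section Components.
Variable G : sgraph.

Section Induced.
Variable S : {set G}.

Definition induced_adj : rel {x : G | x \in S} :=
  fun x y => adj (val x) (val y).

Lemma induced_adj_sym : symmetric induced_adj.
Proof. by move=> x y; apply: adj_sym. Qed.

Lemma induced_adj_irr : irreflexive induced_adj.
Proof. by move=> x; apply: adj_irr. Qed.

Definition induced : sgraph := SGraph induced_adj_sym induced_adj_irr.

End Induced.

Definition component (x : G) : sgraph :=
  induced [set y | connect (@adj G) x y].

(* The bound |E| on gamma_s of the 2-subdivision fails for disconnected graphs
   having star components (for 2K_2 one gets 4 > 2), so "not a star" has to be
   read componentwise; on connected graphs the two readings agree. *)
Lemma star_component_connected :
  (forall x y : G, connect (@adj G) x y) ->
  (forall x : G, ~~ is_star (component x)) <-> ~~ is_star G.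
Proof.
move=> conG; split=> [nstar | nstar x]; apply/existsP => -[c /forallP starc].
- have /existsP[] := nstar c.
  have cC : c \in [set y | connect (@adj G) c y] by rewrite inE.
  exists (Sub c cC : component c); apply/forallP => x; apply/forallP => y.
  by have /forallP/(_ (val y)) := starc (val x).
- case/existsP: nstar; exists (val c).
  have inC z : z \in [set y | connect (@adj G) x y] by rewrite inE.
  apply/forallP => y; apply/forallP => z.
  by have /forallP/(_ (Sub z (inC z))) := starc (Sub y (inC y)).
Qed.

End Components.

(* Main.v *)
Require Import Defs.
From mathcomp Require Import all_boot.

(** Both the set of original vertices and the set of subdivision vertices are
    secure dominating in the 2-subdivision. In the first, a subdivision vertex
    can replace either end of its edge, as every other edge keeps an end. In
    the second, a vertex [v] of [G] can replace the middle of an edge [vw],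
    provided that [w] has a neighbour other than [v]; if no neighbour [w] of [v]
    has one, then the component of [v] is a star centred at [v]. *)

Lemma gamma_s_le {G : sgraph} {D : {set G}} :
  secure_dominating D -> gamma_s G <= #|D|.
Proof.
move=> sdD; rewrite /gamma_s.
by case: arg_minnP => [|S _]; [exact: secure_dominating_setT | exact].
Qed.

Lemma dominatingP {G : sgraph} {D : {set G}} :
  reflect (forall u, u \notin D -> exists2 v, v \in D & adj u v)
          (dominating D).
Proof.
apply: (iffP forallP) => domD u.
  by move=> uD; have /implyP/(_ uD)/exists_inP := domD u.
by apply/implyP => uD; apply/exists_inP; apply: domD.
Qed.

(** An isolated [v] is covered as well, its component being the one-vertex star. Hence the lemma
    also supplies every vertex with a neighbour, which domination by the middles relies on. *)
Lemma nonstar_neighbour {G : sgraph} {v : G} :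
  ~~ is_star (component v) -> exists w x, [/\ adj v w, adj w x & x != v].
Proof.
move=> nstar.
have [/existsP[w /existsP[x /and3P[]]]|none] :=
  boolP [exists w : G, exists x : G, [&& adj v w, adj w x & x != v]].
  by exists w, x.
have back (w x : G) : adj v w -> adj w x -> x = v.
  move=> vw wx; apply/eqP; apply: contraNT none => xv.
  by apply/existsP; exists w; apply/existsP; exists x; rewrite vw wx.
(* Induction along a path from [v]: a step from [v] reaches a neighbour, and by [back] a step from a
   neighbour returns to [v]. *)
have ball (y : G) : connect (@adj G) v y -> (y == v) || adj v y.
  case/connectP=> s; elim/last_ind: s y => [|s z IHs] y /=.
    by move=> _ ->; rewrite eqxx.
  rewrite rcons_path last_rcons => /andP[ps lz] ->.
  case/orP: (IHs _ ps erefl) => [/eqP lv|vl]; first by rewrite -lv lz orbT.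
  by rewrite (back _ _ vl lz) eqxx.
have vC : v \in [set y | connect (@adj G) v y] by rewrite inE.
case/existsP: nstar; exists (Sub v vC : component v).
apply/forallP => x; apply/forallP => y; apply/eqP.
have := valP x; have := valP y; rewrite !inE => /ball vy /ball vx.
rewrite -!val_eqE /= /induced_adj.
have [xv|xv] := eqVneq (val x) v; have [yv|yv] := eqVneq (val y) v.
- by rewrite xv yv adj_irr.
- by move: vy; rewrite xv (negPf yv) /= => ->.
- by move: vx; rewrite yv (negPf xv) /= adj_sym => ->.
(* Two neighbours of [v] are not adjacent: by [back], such an edge would end at [v]. *)
- move: vx; rewrite (negPf xv) /= => vx.
  by apply/negP => xy; case/eqP: yv; apply: back vx xy.
Qed.

Section Subdivision2.
Variable G : sgraph.

Notation H := (subdivision 2 G).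
Notation middle p := (inr (p, ord0) : H).

Lemma subdiv2_adj (v : G) (p : edge G) :
  adj (inl v : H) (middle p) = (v == (val p).1) || (v == (val p).2).
Proof.
have path1 q : subdiv_path 2 q 1 = middle q.
  by rewrite /= insubT; congr (inr (_, _)); apply: val_inj.
(* Here [insub] is applied to 1, which is out of range for ['I_1], so the path takes its default
   value, the second end. *)
have path2 (q : edge G) : subdiv_path 2 q 2 = inl (val q).2.
  by rewrite /= insubN.
apply/existsP/idP => [[q /existsP[[[|[|//]] ltj]]]|].
- rewrite [nat_of_ord _]/= path1 /= orbF => /andP[/eqP[->] /eqP[->]].
  by rewrite eqxx.
- rewrite [nat_of_ord _]/= path1 path2 /= => /andP[/eqP[->] /eqP[->]].
  by rewrite eqxx orbT.
- case/orP=> /eqP->; exists p; apply/existsP.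
    by exists ord0; rewrite path1 !eqxx.
  by exists ord_max; rewrite [nat_of_ord _]/= path1 path2 !eqxx orbT.
Qed.

Lemma middleE (x : edge G * 'I_2.-1) : inr x = middle x.1.
Proof. by case: x => p i; rewrite [i]ord1. Qed.

(** Edges are stored in the order of [enum_rank]. Describing the middle only by its neighbours hides
    that orientation from later arguments. *)
Lemma middle_of_adj {u v : G} : adj u v ->
  exists p : edge G, forall x, adj (inl x : H) (middle p) = (x == u) || (x == v).
Proof.
move=> uv; case: (ltngtP (enum_rank u) (enum_rank v)) => [lt_uv|lt_vu|].
- have pE : (u, v) \in edges G by rewrite inE uv.
  by exists (exist _ (u, v) pE) => x; rewrite subdiv2_adj.
- have pE : (v, u) \in edges G by rewrite inE adj_sym uv.
  by exists (exist _ (v, u) pE) => x; rewrite subdiv2_adj orbC.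
- by move/ord_inj/enum_rank_inj => euv; rewrite euv adj_irr in uv.
Qed.

Definition originals : {set H} := [set inl v | v : G].
Definition middles : {set H} := [set inr x | x : edge G * 'I_2.-1].

Lemma inl_originals (v : G) : (inl v : H) \in originals.
Proof. by apply: imset_f. Qed.

Lemma inr_middles x : (inr x : H) \in middles.
Proof. by apply: imset_f. Qed.

Lemma inl_middles v : (inl v : H) \notin middles.
Proof. by apply/imsetP => -[]. Qed.

Lemma card_originals : #|originals| = #|G|.
Proof. by rewrite card_imset //; apply: inl_inj. Qed.

Lemma card_middles : #|middles| = #|edges G|.
Proof.
by rewrite card_imset; [rewrite card_prod card_ord muln1 card_sig | apply: inr_inj].
Qed.

Lemma secure_dominating_originals : secure_dominating originals.
Proof.
apply/andP; split.
  apply/dominatingP => -[v|x]; first by rewrite inl_originals.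
  exists (inl (val x.1).1); first exact: inl_originals.
  by rewrite middleE adj_sym subdiv2_adj eqxx.
apply/forallP => -[v|x]; first by rewrite inl_originals.
apply/implyP => _; apply/exists_inP; exists (inl (val x.1).1).
  exact: inl_originals.
rewrite middleE adj_sym subdiv2_adj eqxx /=.
apply/dominatingP => -[v|y].
  rewrite !inE inl_originals andbT negbK => /eqP ->.
  by exists (middle x.1); rewrite ?setU11 // subdiv2_adj eqxx.
move=> _; have yE := valP y.1; rewrite inE in yE.
have neq12 : (val y.1).1 != (val y.1).2.
  by apply: contraTneq yE => ->; rewrite adj_irr.
(* Only the first end of [x.1] has left the set. If it is the first end of [y.1], the second end of
   [y.1] differs from it and remains. *)
rewrite (middleE y); have [e1|n1] := eqVneq (val y.1).1 (val x.1).1.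
  exists (inl (val y.1).2); last by rewrite adj_sym subdiv2_adj eqxx orbT.
  by rewrite !inE inl_originals andbT -e1; apply: contraNneq neq12 => -[->].
exists (inl (val y.1).1); last by rewrite adj_sym subdiv2_adj eqxx.
by rewrite !inE inl_originals andbT (inj_eq (@inl_inj _ _)) n1.
Qed.

Lemma secure_dominating_middles :
  (forall x : G, ~~ is_star (component x)) -> secure_dominating middles.
Proof.
move=> nstar; apply/andP; split.
  apply/dominatingP => -[v _|x]; last by rewrite inr_middles.
  have [w [x [vw _ _]]] := nonstar_neighbour (nstar v).
  have [p adjp] := middle_of_adj vw.
  by exists (middle p); rewrite ?inr_middles // adjp eqxx.
apply/forallP => -[v|x]; last by rewrite inr_middles.
apply/implyP => _; apply/exists_inP.
have [w [x [vw wx xv]]] := nonstar_neighbour (nstar v).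
have [p adjp] := middle_of_adj vw; have [q adjq] := middle_of_adj wx.
have neq_wv : w != v by apply: contraTneq vw => ->; rewrite adj_irr.
(* Otherwise [v] would be an end of [q], but it is neither [w] nor [x]. *)
have neq_pq : middle q != middle p.
  apply: contraNneq xv => eq_qp; have := adjq v.
  rewrite eq_qp adjp eqxx [v == w]eq_sym (negPf neq_wv).
  by rewrite [v == x]eq_sym /= => <-.
exists (middle p); rewrite ?inr_middles // adjp eqxx /=.
apply/dominatingP => -[u|y].
  rewrite !inE (negPf (inl_middles _)) andbF orbF => neq_uv.
  (* Removing the middle of [p] can only harm [v] and [w]. The former is now in the set, and the
     latter keeps the middle of [q]. *)
  have [->|neq_uw] := eqVneq u w.
    by exists (middle q); rewrite ?inE ?neq_pq ?inr_middles // adjq eqxx.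
  have [t [z [ut _ _]]] := nonstar_neighbour (nstar u).
  have [r adjr] := middle_of_adj ut.
  exists (middle r); last by rewrite adjr eqxx.
  (* The edge [r] has the end [u], which is not an end of [p], so its middle was not removed. *)
  rewrite !inE inr_middles andbT.
  apply: contraNneq neq_uv => eq_rp; have := adjr u.
  by rewrite eq_rp adjp eqxx (negPf neq_uw) orbF => /eqP ->.
rewrite !inE inr_middles andbT negbK => /eqP ->.
by exists (inl v); rewrite ?setU11 // adj_sym adjp eqxx.
Qed.

End Subdivision2.

Theorem theorem2p3 (G : sgraph)
    (hG : forall x : G, ~~ is_star (component x)) :
  gamma_s (subdivision 2 G) <= minn #|edges G| #|G|.
Proof.
rewrite leq_min -card_middles -card_originals.
rewrite (gamma_s_le (secure_dominating_middles G hG)).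
exact: gamma_s_le (secure_dominating_originals G).
Qed.
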